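(* Let $(G,\star,g)$ be a log-Euclidean Lie group equipped with a log-Euclidean metric $g$, and let $H$ be a connected closed subgroup of $G$ with quotient Riemannian submersion $\pi:(G,g)\to(G/H,g^Q)$. Let $s$ be the section of the principal $H$-bundle $\pi:G\to G/H$ defined by $$s:G/H\longrightarrow G,\qquad [p]\longmapsto\exp_G\bigl(s_{\mathrm{lin}}(\log_G(p)+\mathfrak h)\bigr),$$ where $s_{\mathrm{lin}}$ is the linear splitting $$s_{\mathrm{lin}}=(\mathrm d_{e_G}\pi|_{\mathfrak m})^{-1}:\mathfrak g/\mathfrak h\to\mathfrak m:=\mathfrak h^\perp.$$ Then $s$ is the unique smooth section of $\pi$ that is both an isometric embedding $(G/H,g^Q)\hookrightarrow(G,g)$ and a Lie group homomorphism, i.e. a Lie group isomorphism from $G/H$ onto its image.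
   Context: A log-Euclidean Lie group is a smooth manifold $G$ with a diffeomorphism $\log_G:G\to\mathfrak g$ onto a finite-dimensional real vector space $\mathfrak g$ (identified with the Lie algebra $T_{e_G}G$), with inverse $\exp_G$, equipped with the commutative Lie group law $u\star v=\exp_G(\log_G(u)+\log_G(v))$. A log-Euclidean metric is $g=\log_G^*\langle\cdot,\cdot\rangle$ for an inner product $\langle\cdot,\cdot\rangle$ on $\mathfrak g$. $\mathfrak h=\log_G(H)$ is a linear subspace of $\mathfrak g$, $\mathfrak h^\perp$ is its orthogonal complement for $\langle\cdot,\cdot\rangle$, and $\mathrm d_{e_G}\pi:\mathfrak g\to\mathfrak g/\mathfrak h$ is $X\mapsto X+\mathfrak h$ (identifying $T_{[e_G]}(G/H)$ with $\mathfrak g/\mathfrak h$). $g^Q$ is the unique Riemannian metric on $G/H$ making $\pi$ a Riemannian submersion. A section $\sigma$ ($\pi\circ\sigma=\mathrm{id}_{G/H}$) is an isometric embedding if it is a smooth embedding with $\sigma^*g=g^Q$. *)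

(* Defs.v *)
From HB Require Import structures.
From mathcomp Require Import all_boot all_order all_algebra.
From mathcomp Require Import all_classical all_reals all_analysis.

Set Implicit Arguments.
Unset Strict Implicit.
Unset Printing Implicit Defensive.

Import Order.TTheory GRing.Theory Num.Theory.
Import numFieldNormedType.Exports VectorInternalTheory.

Local Open Scope classical_set_scope.
Local Open Scope ring_scope.
Local Open Scope quotient_scope.

Section SmoothCalculus.
Variables (R : realType) (E F : normedModType R).

(* For finite-dimensional E and open U, this is the class C^k on U. *)
Fixpoint Ck (k : nat) (U : set E) (f : E -> F) : Prop :=
  if k is k'.+1 then
    (forall x, U x -> differentiable f x) /\
    (forall v : E, Ck k' U (fun x => 'D_v f x))
  else forall x, U x -> {for x, continuous f}.

Definition Cinfty (U : set E) (f : E -> F) : Prop := forall k, Ck k U f.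

End SmoothCalculus.

Section SmoothManifolds.
Variable R : realType.

Record chart (T : topologicalType) (n : nat) := Chart {
  cdom : set T;
  cmap : T -> 'rV[R]_n;
  cinv : 'rV[R]_n -> T;
  cdom_open : open cdom;
  ccod_open : open (cmap @` cdom);
  cmapK : forall p, cdom p -> cinv (cmap p) = p;
  cmap_continuous : forall p, cdom p -> {for p, continuous cmap};
  cinv_continuous : forall x, (cmap @` cdom) x -> {for x, continuous cinv} }.

(* The atlas is not required to be maximal; every notion below is insensitive
   to enlarging it by compatible charts. *)
Record smoothStructure (T : topologicalType) := SmoothStructure {
  sdim : nat;
  satlas : set (chart T sdim);
  satlas_cover : forall p, exists c, satlas c /\ cdom c p;
  satlas_compat : forall c c', satlas c -> satlas c' ->
    Cinfty (cmap c @` (cdom c `&` cdom c')) (cmap c' \o cinv c);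
  smooth_hausdorff : hausdorff_space T;
  smooth_second_countable : @second_countable T }.

Arguments satlas [T] s _.

Record manifold := Manifold {
  msort :> topologicalType;
  mstruct : smoothStructure msort }.

Definition mdim (M : manifold) : nat := sdim (mstruct M).
Definition atlas (M : manifold) : set (chart M (mdim M)) := satlas (mstruct M).

Definition charts_at (M : manifold) (p : M) : set (chart M (mdim M)) :=
  [set c | atlas c /\ cdom c p].

Definition chart_at (M : manifold) (p : M) : chart M (mdim M) :=
  projT1 (cid (satlas_cover (mstruct M) p)).

Definition smooth_map_on (M N : manifold) (W : set M) (f : M -> N) : Prop :=
  (forall p, W p -> {for p, continuous f}) /\
  (forall c c', @atlas M c -> @atlas N c' ->
     Cinfty (cmap c @` (W `&` cdom c `&` f @^-1` cdom c'))
            (cmap c' \o f \o cinv c)).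

Definition smooth_map (M N : manifold) (f : M -> N) : Prop :=
  smooth_map_on setT f.

Definition diffeomorphism (M N : manifold) (f : M -> N) (f' : N -> M) : Prop :=
  [/\ cancel f f', cancel f' f, smooth_map f & smooth_map f'].

(* Smoothness of a map on an arbitrary subset of a manifold, in particular on
   an embedded submanifold: local extendability to a smooth map. *)
Definition smooth_on_subset (M N : manifold) (A : set M) (f : M -> N) : Prop :=
  forall p, A p -> exists W (F : M -> N),
    [/\ open W, W p, smooth_map_on W F & forall x, W x -> A x -> F x = f x].

(* A tangent vector at p is the family of its coordinate vectors in the charts
   around p, related by the differentials of the transition maps.  Components
   at charts not containing p are set to 0, so that T_p M is a linear subspace
   of the function space [tvec M] and equality of vectors is Leibniz. *)
Definition tvec (M : manifold) : lmodType R :=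
  chart M (mdim M) -> 'rV[R]_(mdim M).

Definition tangent (M : manifold) (p : M) : set (tvec M) :=
  [set v | (forall c c', charts_at p c -> charts_at p c' ->
              v c' = 'd (cmap c' \o cinv c) (cmap c p) (v c)) /\
           (forall c, ~ charts_at p c -> v c = 0)].

(* The vector at p with coordinates x in the chart c (for c around p). *)
Definition coord_vec (M : manifold) (c : chart M (mdim M)) (p : M)
    (x : 'rV[R]_(mdim M)) : tvec M :=
  fun c' => if `[< charts_at p c' >]
            then 'd (cmap c' \o cinv c) (cmap c p) x else 0.

(* The differential d_p f : T_p M -> T_(f p) N of a smooth map f; it does not
   depend on the chart used at p. *)
Definition tmap (M N : manifold) (f : M -> N) (p : M) (v : tvec M) : tvec N :=
  fun c' => if `[< charts_at (f p) c' >]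
            then 'd (cmap c' \o f \o cinv (chart_at p))
                    (cmap (chart_at p) p) (v (chart_at p))
            else 0.

(* Only the values g p v w at v, w in T_p M are meaningful. *)
Definition metric_field (M : manifold) := M -> tvec M -> tvec M -> R.

Definition riemannian (M : manifold) (g : metric_field M) : Prop :=
  [/\ forall p (a : R) (u v w : tvec M),
        tangent p u -> tangent p v -> tangent p w ->
        g p (a *: u + v) w = a * g p u w + g p v w,
      forall p (v w : tvec M),
        tangent p v -> tangent p w -> g p v w = g p w v,
      forall p (v : tvec M), tangent p v -> v <> 0 -> 0 < g p v v &
      forall c (x y : 'rV[R]_(mdim M)), atlas c ->
        Cinfty (cmap c @` cdom c)
          (fun z => g (cinv c z) (coord_vec c (cinv c z) x)
                      (coord_vec c (cinv c z) y) : R^o)].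

Definition pullback_metric (M N : manifold) (f : M -> N) (g : metric_field N) :
    metric_field M :=
  fun p v w => g (f p) (tmap f p v) (tmap f p w).

Definition submersion (M N : manifold) (f : M -> N) : Prop :=
  smooth_map f /\
  forall p w, tangent (f p) w -> exists2 v, tangent p v & tmap f p v = w.

Definition horizontal (M N : manifold) (g : metric_field M) (f : M -> N)
    (p : M) : set (tvec M) :=
  [set v | tangent p v /\
     forall u, tangent p u -> tmap f p u = 0 -> g p v u = 0].

Definition riemannian_submersion (M N : manifold) (g : metric_field M)
    (g' : metric_field N) (f : M -> N) : Prop :=
  submersion f /\
  forall p v w, horizontal g f p v -> horizontal g f p w ->
    pullback_metric f g' p v w = g p v w.

Definition smooth_embedding (M N : manifold) (f : M -> N) : Prop :=
  [/\ smooth_map f,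
      forall p v w, tangent p v -> tangent p w ->
        tmap f p v = tmap f p w -> v = w,
      injective f &
      forall U : set M, open U -> exists2 V, open V & U = f @^-1` V].

Definition isometric_embedding (M N : manifold) (g : metric_field M)
    (g' : metric_field N) (f : M -> N) : Prop :=
  smooth_embedding f /\
  forall p v w, tangent p v -> tangent p w ->
    pullback_metric f g' p v w = g p v w.

End SmoothManifolds.

Section SecondCountable.
Variables (R : realType) (n : nat).

Definition rat_ball (a : 'rV[rat]_n * nat) : set 'rV[R]_n :=
  ball (map_mx ratr a.1 : 'rV[R]_n) (a.2.+1%:R^-1).

Lemma rV_second_countable : @second_countable 'rV[R]_n.
Proof.
exists (rat_ball @` setT).
  by apply: sub_countable (card_image_le _ _) (countableP _).
split=> [_ [a _ <-]|x U /nbhs_ballP[e /= e0 xeU]].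
  by apply: ball_open; rewrite invr_gt0.
have e20 : 0 < e / 2 by rewrite divr_gt0.
have [k _ /(_ k (leqnn k)) /= ke] := near_infty_natSinv_lt (PosNum e20).
have k0 : (0 : R) < k.+1%:R^-1 by rewrite invr_gt0.
have /choice[q qx] i : exists q : rat, `|x 0 i - ratr q| < k.+1%:R^-1.
  have [|q] := @rat_in_itvoo R (x 0 i - k.+1%:R^-1) (x 0 i + k.+1%:R^-1).
    by rewrite ltrD2l (lt_trans _ k0)// oppr_lt0.
  rewrite in_itv/= => qx; exists q; rewrite distrC ltr_distl; exact: qx.
have xq : ball (x : 'rV[R]_n) (k.+1%:R^-1) (map_mx ratr (\row_i q i)).
  by split=> // i j; rewrite !mxE ord1; exact: qx.
exists (rat_ball (\row_i q i, k)).
  by split; [exists (\row_i q i, k)|exact: ball_sym].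
move=> y; rewrite /rat_ball/= => qy; apply: xeU.
apply: (@le_ball _ _ _ (k.+1%:R^-1 + k.+1%:R^-1)); last exact: ball_triangle qy.
by rewrite (splitr e) lerD// ltW.
Qed.

End SecondCountable.

Section VectorSpaceManifold.
Variables (R : realType) (V : vectType R).

(* The standard topology of a finite-dimensional vector space, transported
   from R^n along linear coordinates. *)
Definition vspace_top : topologicalType :=
  initial_topology (v2r : V -> 'rV[R]_(dim V)).

Lemma v2r_vspace_continuous :
  continuous (v2r : vspace_top -> 'rV[R]_(dim V)).
Proof. exact: initial_continuous. Qed.

Lemma r2v_vspace_continuous :
  continuous (r2v : 'rV[R]_(dim V) -> vspace_top).
Proof.
apply/continuousP => _ [B oB <-].
by rewrite (_ : _ @^-1` _ = B)//; apply/seteqP; split=> x /=; rewrite r2vK.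
Qed.

Lemma vspace_hausdorff : hausdorff_space vspace_top.
Proof.
move=> p q pq; apply: (@v2r_inj _ V); apply: norm_hausdorff => A B Ap Bq.
have [z [Az Bz]] := pq _ _ (v2r_vspace_continuous Ap) (v2r_vspace_continuous Bq).
by exists (v2r z).
Qed.

Lemma vspace_second_countable : @second_countable vspace_top.
Proof.
have [B cB [oB nB]] := @rV_second_countable R (dim V).
exists ((fun U => (v2r : V -> _) @^-1` U) @` B).
  exact: sub_countable (card_image_le _ _) cB.
split=> [_ [U BU <-]|p W /= Wp].
  by exists U => //; exact: oB.
have /nB[U [BU Up] UW] : nbhs (v2r p) ((r2v : _ -> vspace_top) @^-1` W).
  by apply: r2v_vspace_continuous; rewrite v2rK.
exists (v2r @^-1` U); first by split=> //; exists U.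
by move=> z /UW /=; rewrite v2rK.
Qed.

Program Definition vspace_chart : chart R vspace_top (dim V) :=
  @Chart R vspace_top (dim V) setT v2r r2v openT _ _ _ _.
Next Obligation.
rewrite (_ : _ @` _ = setT); first exact: openT.
by apply/seteqP; split=> // x _; exists (r2v x) => //; rewrite r2vK.
Qed.
Next Obligation. by move=> p _; rewrite v2rK. Qed.
Next Obligation. by move=> p _; exact: v2r_vspace_continuous. Qed.
Next Obligation. by move=> x _; exact: r2v_vspace_continuous. Qed.

Lemma Ck_cst (E F : normedModType R) (a : F) k (U : set E) :
  Ck k U (fun=> a).
Proof.
elim: k a => [|k IH] a /=; first by move=> x _; exact: cst_continuous.
split=> [x _|v]; first exact: differentiable_cst.
by under eq_fun do rewrite derive_cst; exact: IH.
Qed.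

Lemma Cinfty_id (E : normedModType R) (U : set E) : Cinfty U id.
Proof.
case=> [|k] /=; first by move=> x _; exact: cvg_id.
split=> [x _|v]; first exact: ex_diff.
by under eq_fun do rewrite derive_id; exact: Ck_cst.
Qed.

Program Definition vspace_structure : smoothStructure R vspace_top :=
  @SmoothStructure R vspace_top (dim V) [set vspace_chart] _ _
    vspace_hausdorff vspace_second_countable.
Next Obligation. by move=> p; exists vspace_chart. Qed.
Next Obligation.
move=> _ _ -> ->; rewrite (_ : _ \o _ = id); last first.
  by apply/funext => x /=; rewrite r2vK.
exact: Cinfty_id.
Qed.

Definition vspace_manifold : manifold R := Manifold vspace_structure.

(* An inner product on V as a Riemannian metric, through T_X V = V. *)
Definition vspace_metric (ip : {dot V for idfun}) :
    metric_field vspace_manifold :=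
  fun _ v w => ip (r2v (v vspace_chart : 'rV[R]_(dim V)) : V)
                  (r2v (w vspace_chart : 'rV[R]_(dim V)) : V).

End VectorSpaceManifold.

(* The manifold G with log_G : G -> V a diffeomorphism of inverse exp_G. *)
Record logEuclideanGroup (R : realType) (V : vectType R) := LogEuclideanGroup {
  le_manifold :> manifold R;
  logG : le_manifold -> V;
  expG : V -> le_manifold;
  logG_diffeomorphism :
    @diffeomorphism R le_manifold (vspace_manifold V) logG expG }.

Arguments logG [R V] _ _.
Arguments expG [R V] _ _.

Section LogEuclidean.
Variables (R : realType) (V : vectType R) (G : logEuclideanGroup V).

Definition lemul (u v : G) : G := expG G (logG G u + logG G v).
Definition leone : G := expG G 0.
Definition leinv (u : G) : G := expG G (- logG G u).

Definition le_metric (ip : {dot V for idfun}) : metric_field G :=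
  @pullback_metric R G (vspace_manifold V) (logG G) (vspace_metric ip).

Definition subgroup (H : set G) : Prop :=
  [/\ H leone, forall u v, H u -> H v -> H (lemul u v) &
      forall u, H u -> H (leinv u)].

Definition lcoset (H : set G) (p : G) : set G := [set lemul p h | h in H].

(* Two elements are identified when they have the same coset; this is an
   equivalence for any set H, hence needs no proof that H is a subgroup. *)
Definition coset_rel (H : set G) : rel G :=
  fun p q => `[< lcoset H p = lcoset H q >].

Lemma coset_rel_equiv (H : set G) : equiv_class_of (coset_rel H).
Proof.
split=> [p|p q|q p r]; first exact/asboolP.
  by apply/asboolP/asboolP.
by move=> /asboolP pq /asboolP qr; apply/asboolP; rewrite pq.
Qed.

Canonical coset_equiv (H : set G) := EquivRelPack (coset_rel_equiv H).

Definition coset_space (H : set G) : topologicalType :=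
  quotient_topology {eq_quot coset_equiv H}.

Definition coset_proj (H : set G) (p : G) : coset_space H :=
  \pi_(coset_space H) p.

Definition cosetmul (H : set G) (a b : coset_space H) : coset_space H :=
  coset_proj H (lemul (repr a) (repr b)).

Definition coset_manifold (H : set G) (S : smoothStructure R (coset_space H)) :
  manifold R := Manifold S.

(* The smooth structure of the homogeneous space G/H: the unique one for which
   the projection is smooth and admits smooth local sections. *)
Definition homogeneous_structure (H : set G)
    (S : smoothStructure R (coset_space H)) : Prop :=
  @smooth_map R G (coset_manifold S) (coset_proj H) /\
  forall a : coset_space H, exists W (tau : coset_space H -> G),
    [/\ open W, W a, @smooth_map_on R (coset_manifold S) G W tau &
        forall b, W b -> coset_proj H (tau b) = b].

(* log_G(H), the Lie algebra of a connected closed subgroup H. *)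
Definition lie_sub (H : set G) : set V := logG G @` H.

Definition orthocomp (ip : {dot V for idfun}) (h : set V) : set V :=
  [set X | forall Y, h Y -> ip X Y = 0].

(* d_e pi : V -> V/h, elements of V/h being the cosets of h in V. *)
Definition dpi (h : set V) (X : V) : set V := [set X + Y | Y in h].

(* The inverse of d_e pi restricted to the orthogonal complement of h. *)
Definition slin (ip : {dot V for idfun}) (h : set V) (C : set V) : V :=
  xget 0 [set X | orthocomp ip h X /\ dpi h X = C].

Definition horizontal_section (ip : {dot V for idfun}) (H : set G)
    (a : coset_space H) : G :=
  expG G (slin ip (lie_sub H) (dpi (lie_sub H) (logG G (repr a)))).

Section Sections.
Variables (H : set G) (S : smoothStructure R (coset_space H)).
Let Q := coset_manifold S.
Variable s : coset_space H -> G.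

Definition smooth_section : Prop :=
  @smooth_map R Q G s /\ cancel s (coset_proj H).

Definition lie_group_morphism : Prop :=
  @smooth_map R Q G s /\ forall a b, s (cosetmul a b) = lemul (s a) (s b).

(* The image is an embedded Lie subgroup of G and the corestriction of s to it
   is a bijective morphism with smooth inverse. *)
Definition lie_group_iso_onto_image : Prop :=
  [/\ lie_group_morphism, @smooth_embedding R Q G s, subgroup (range s) &
      exists r : G -> coset_space H,
        cancel s r /\ @smooth_on_subset R G Q (range s) r].

End Sections.

End LogEuclidean.

Arguments leone [R V] _.
Arguments le_metric [R V] _ _.
Arguments horizontal_section [R V G] _ _ _.
Arguments coset_manifold [R V G] _ _.

(* Main.v *)
Require Import Defs.
From HB Require Import structures.
From mathcomp Require Import all_boot all_order all_algebra.
From mathcomp Require Import all_classical all_reals all_analysis.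
Import numFieldNormedType.Exports.
Import Order.TTheory GRing.Theory Num.Theory VectorInternalTheory.
Local Open Scope classical_set_scope.
Local Open Scope ring_scope.

(* A closed connected subgroup of a finite-dimensional space is a linear
   subspace, so h = log_G(H) has an orthogonal projection P and the section is
   s [p] = exp_G (P (log_G p)).  It is smooth because locally
   s = exp_G \o P \o log_G \o tau for a smooth local section tau of pi.
   Differentiating log_G \o s = P \o log_G \o s and
   P \o log_G = log_G \o s \o pi shows that d s takes horizontal values, so s
   is isometric because pi is a Riemannian submersion.  Conversely, a
   homomorphic section f yields the smooth additive map
   T = log_G \o f \o pi \o exp_G of the Lie algebra, which is its own
   differential at 0; if f is isometric at the identity then T X has the same
   norm as P X, while T X - P X lies in h, and Pythagoras forces T = P. *)

Set Implicit Arguments.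
Unset Strict Implicit.
Unset Printing Implicit Defensive.

(** * Calculus of C^k maps *)

Section Differentiability.
Context {R : realType}.
Implicit Types E F : normedModType R.

(** The zero map satisfies the first-order expansion that characterises the differential, and
    [diff_unique] identifies it with ['d f x]. *)
Lemma near0_differentiable E F (f : E -> F) x :
  (\forall y \near x, f y = 0) -> differentiable f x.
Proof.
move=> fx0; have f0 : f x = 0 := nbhs_singleton fx0.
pose z : {linear E -> F} := \0.
have fo : f \o shift x = cst (f x) + z +o_ 0 id.
  apply/eqaddoP => e e0; move: fx0; rewrite (near_shift 0 x) subr0.
  apply: filterS => h /= fh0.
  by rewrite !fctE /= fh0 f0 /z /= !addr0 subrr normr0 mulr_ge0 // ltW.
have cz : continuous z by move=> y; exact: cst_continuous.
by apply/diff_locallyP; rewrite (diff_unique cz fo).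
Qed.

Lemma near_eq_differentiable E F (f g : E -> F) x :
  {near x, f =1 g} -> differentiable f x -> differentiable g x.
Proof.
move=> fg df; rewrite (_ : g = f + (g - f)); last by rewrite addrC subrK.
apply: differentiableD => //; apply: near0_differentiable.
by apply: filterS fg => y /= fg; rewrite !fctE fg subrr.
Qed.

Lemma near_eq_diff E F (f g : E -> F) x v :
  {near x, f =1 g} -> differentiable f x -> 'd f x v = 'd g x v.
Proof.
move=> fg df; rewrite -!deriveE //; first exact: near_eq_derive.
exact: near_eq_differentiable df.
Qed.

Lemma linear_rV_continuous n F (f : {linear 'rV[R]_n -> F}) : continuous f.
Proof.
have -> : f = \sum_i (fun x : 'rV[R]_n => x 0 i *: f (delta_mx 0 i)) :> (_ -> _).
  apply/funext => x; rewrite {1}(row_sum_delta x) linear_sum fct_sumE.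
  by apply: eq_bigr => i _; rewrite linearZ.
move=> x; apply: differentiable_continuous; apply: differentiable_sum => i.
exact/differentiableZl/differentiable_coord.
Qed.

Lemma derive_comp_lin E F1 F (L : {linear F1 -> F}) (f : E -> F1) x v :
  continuous L -> differentiable f x -> 'D_v (L \o f) x = L ('D_v f x).
Proof.
move=> cL df; have dL := linear_differentiable (f x) cL.
rewrite (deriveE v (differentiable_comp df dL)) (deriveE v df).
by rewrite (diff_comp df dL) /= (diff_lin _ cL).
Qed.

Lemma Ck_subset E F k (U W : set E) (f : E -> F) : U `<=` W -> Ck k W f -> Ck k U f.
Proof.
move=> UW; elim: k f => [|k IH] f /=; first by move=> h x /UW/h.
by move=> [h1 h2]; split=> [x /UW/h1//|v]; exact/IH/h2.
Qed.

(** [Ck k W f] is a conjunction of conditions at the points of [W], on derivatives taken in the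
    ambient space; hence the sets [W] need be neither open nor contained in [U]. *)
Lemma Ck_pointwise E F k (U : set E) (f : E -> F) :
  (forall x, U x -> exists2 W : set E, W x & Ck k W f) -> Ck k U f.
Proof.
elim: k f => [|k IH] f h /=; first by move=> x /h[W Wx]; apply.
split=> [x /h[W Wx [+ _]]|v]; first by apply.
by apply: IH => x /h[W Wx [_ DfW]]; exists W => //; exact: DfW.
Qed.

Lemma eq_Ck E F k (U : set E) (f g : E -> F) : open U ->
  {in U, f =1 g} -> Ck k U f -> Ck k U g.
Proof.
move=> oU; elim: k f g => [|k IH] f g fg.
all: have near_fg x : U x -> {near x, f =1 g}
  by move=> Ux; apply: filterS (open_nbhs_nbhs (conj oU Ux)) => y Uy; rewrite fg // inE.
  move=> cf x Ux; rewrite /prop_for /continuous_at -(nbhs_singleton (near_fg _ Ux)).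
  by apply: cvg_trans (cf x Ux); apply: near_eq_cvg; exact: near_fg.
move=> [df Df]; split=> [x Ux|v]; first last.
  apply: IH (Df v) => x; rewrite inE => Ux; exact: near_eq_derive (near_fg _ Ux).
exact: near_eq_differentiable (near_fg _ Ux) (df x Ux).
Qed.

Lemma CkS E F k (U : set E) (f : E -> F) : Ck k.+1 U f -> Ck k U f.
Proof.
elim: k f => [|k IH] f; first by move=> [df _] x /df/differentiable_continuous.
by move=> [df Df]; split=> // v; exact/IH/Df.
Qed.

Lemma Ck_comp_lin E F1 F k (U : set E) (L : {linear F1 -> F}) (f : E -> F1) :
  open U -> continuous L -> Ck k U f -> Ck k U (L \o f).
Proof.
move=> oU cL; elim: k f => [|k IH] f /=.
  by move=> cf x /cf cfx; apply: continuous_comp cfx _; exact: cL.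
move=> [df Df]; split=> [x Ux|v].
  exact: differentiable_comp (df _ Ux) (linear_differentiable _ cL).
apply: eq_Ck (IH _ (Df v)) => // x; rewrite inE => Ux.
by rewrite derive_comp_lin //; exact: df.
Qed.

Lemma CkD E F k (U : set E) (f g : E -> F) : open U ->
  Ck k U f -> Ck k U g -> Ck k U (f + g).
Proof.
move=> oU; elim: k f g => [|k IH] f g /=.
  by move=> cf cg x Ux; apply: cvgD; [exact: cf|exact: cg].
move=> [df Df] [dg Dg]; split=> [x Ux|v].
  by apply: differentiableD; [exact: df|exact: dg].
apply: eq_Ck (IH _ _ (Df v) (Dg v)) => // x; rewrite inE => Ux.
by rewrite deriveD //; apply: diff_derivable; [exact: df|exact: dg].
Qed.

Lemma Ck_sum E F k (U : set E) I (r : seq I) (f : I -> E -> F) : open U ->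
  (forall i, Ck k U (f i)) -> Ck k U (\sum_(i <- r) f i).
Proof.
move=> oU h; elim/big_ind : _ => //; first exact: Ck_cst.
by move=> g g'; exact: CkD.
Qed.

Lemma CkM E k (U : set E) (f g : E -> R^o) : open U ->
  Ck k U f -> Ck k U g -> Ck k U (f * g : E -> R^o).
Proof.
move=> oU; elim: k f g => [|k IH] f g.
  by move=> cf cg x Ux; apply: cvgM; [exact: cf|exact: cg].
move=> Cf Cg; have [df Df] := Cf; have [dg Dg] := Cg; split=> [x Ux|v].
  by apply: differentiableM; [exact: df|exact: dg].
apply: (@eq_Ck _ _ _ _ (f * 'D_v g + g * 'D_v f : E -> R^o)) => //.
  move=> x; rewrite inE => Ux.
  have dfx := diff_derivable (df _ Ux) (v := v).
  have dgx := diff_derivable (dg _ Ux) (v := v).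
  by rewrite (deriveM dfx dgx).
(* The product rule pairs a derivative with an undifferentiated factor, which [CkS] lowers to the
   regularity of the induction hypothesis. *)
by apply: CkD => //; apply: IH; by [exact: CkS|exact: Dg|exact: Df].
Qed.

Lemma Ck_coord E n k (U : set E) (f : E -> 'rV[R]_n) : open U ->
  Ck k U f <-> forall i, Ck k U (fun x => f x 0 i : R^o).
Proof.
move=> oU; split=> [Cf i|Cf].
  have lin : linear (fun x : 'rV[R]_n => x 0 i : R^o) by move=> a u v; rewrite !mxE.
  pose L : {linear 'rV[R]_n -> R^o} :=
    HB.pack (fun x : 'rV[R]_n => x 0 i : R^o) (GRing.isLinear.Build _ _ _ _ _ lin).
  by apply: (@Ck_comp_lin _ _ _ _ _ L) => //; exact: coord_continuous.
have -> : f = \sum_i (( *:%R^~ (delta_mx 0 i)) \o (fun x => f x 0 i : R^o)).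
  by apply/funext => x; rewrite fct_sumE {1}(row_sum_delta (f x)).
apply: Ck_sum => // i.
have lin : linear ( *:%R^~ (delta_mx 0 i) : R^o -> 'rV[R]_n).
  by move=> a u v; rewrite scalerDl scalerA.
pose L : {linear R^o -> 'rV[R]_n} :=
  HB.pack ( *:%R^~ (delta_mx 0 i)) (GRing.isLinear.Build _ _ _ _ _ lin).
apply: (@Ck_comp_lin _ _ _ _ _ L) => //; exact: scalel_continuous.
Qed.

(** By the chain rule, the derivative of [g \o f] along [v] is the sum over [i] of the [i]-th
    coordinate of ['D_v f] times the [i]-th partial derivative of [g] composed with [f]. A scalar
    target makes these terms products, so [CkM] and induction on [k] apply. *)
Lemma Ck_comp_scalar E n k (U : set E) (W : set 'rV[R]_n) (f : E -> 'rV[R]_n)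
    (g : 'rV[R]_n -> R^o) : open U -> open W -> f @` U `<=` W ->
  Ck k U f -> Ck k W g -> Ck k U (g \o f).
Proof.
move=> oU oW fUW; elim: k g => [|k IH] g Cf Cg.
  by move=> x Ux; apply: continuous_comp; [exact: Cf|apply/Cg/fUW; exists x].
have [df Df] := Cf; have [dg Dg] := Cg.
have dgf x : U x -> differentiable g (f x) by move=> Ux; apply/dg/fUW; exists x.
split=> [x Ux|v]; first by apply: differentiable_comp; [exact: df|exact: dgf].
pose h i : E -> R^o := (fun x => 'D_v f x 0 i : R^o) * ('D_(delta_mx 0 i) g \o f).
apply: (@eq_Ck _ _ _ _ (\sum_i h i)) => //.
  move=> x; rewrite inE => Ux.
  have dfx := df _ Ux; have dgx := dgf _ Ux.
  rewrite (deriveE v (differentiable_comp dfx dgx)) (diff_comp dfx dgx) /=.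
  rewrite -(deriveE v dfx).
  rewrite (row_sum_delta ('D_v f x)) linear_sum fct_sumE.
  by apply: eq_bigr => i _; rewrite linearZ /= -(deriveE _ dgx).
apply: Ck_sum => // i; apply: CkM => //; first exact: (Ck_coord _ _ oU).1 (Df v) i.
exact: IH (CkS Cf) (Dg _).
Qed.

Lemma Ck_comp E n p k (U : set E) (W : set 'rV[R]_n) (f : E -> 'rV[R]_n)
    (g : 'rV[R]_n -> 'rV[R]_p) : open U -> open W -> f @` U `<=` W ->
  Ck k U f -> Ck k W g -> Ck k U (g \o f).
Proof.
move=> oU oW fUW Cf /(Ck_coord _ _ oW) Cg; apply/Ck_coord => // j.
exact: (Ck_comp_scalar oU oW fUW Cf (Cg j)).
Qed.
End Differentiability.

(** * Closed connected subgroups *)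

Section ClosedSubgroups.
Variables (R : realType) (n : nat).
Implicit Types A Z : set 'rV[R]_n.

Lemma subgroup_mulrz A (z : int) x : A 0 ->
  (forall x y, A x -> A y -> A (x - y)) -> A x -> A (x *~ z).
Proof.
move=> A0 AB Ax.
have AN y : A y -> A (- y) by rewrite -sub0r; exact: AB.
have An k : A (x *+ k).
  elim: k => [|k IH]; first by rewrite mulr0n.
  by rewrite mulrS -[x *+ k]opprK; apply: (AB) => //; exact: AN.
by case: z => k; [rewrite -pmulrn|rewrite NegzE mulrNz -pmulrn; exact: AN].
Qed.

(* The line is spanned by a cluster point [u] of the directions of small
   elements [b]: the multiples [b *~ floor (t / |b|)] approximate [t *: u]. *)
Lemma closed_subgroup_line A Z : closed A -> A 0 ->
  (forall x y, A x -> A y -> A (x - y)) ->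
  closed Z -> (forall (t : R) x, Z x -> Z (t *: x)) ->
  (forall e, 0 < e -> exists b, [/\ A b, Z b, b != 0 & `|b| < e]) ->
  exists u, [/\ u != 0, Z u & forall t : R, A (t *: u)].
Proof.
move=> cA A0 AB cZ sZ small.
have /choice[b bP] k : exists b, [/\ A b, Z b, b != 0 & `|b| < k.+1%:R^-1].
  by apply: small; rewrite invr_gt0.
have b0 k : 0 < `|b k| by rewrite normr_gt0; have [] := bP k.
pose v k := `|b k|^-1 *: b k.
have normv k : `|v k| = 1 by rewrite normrZ normfV normr_id mulVf ?gt_eqF.
pose Sph := [set x : 'rV[R]_n | `|x| = 1].
have cS : closed Sph.
  apply: (@closed_comp _ _ (fun x : 'rV[R]_n => `|x|) [set 1]); last exact: closed_eq.
  by move=> x _; exact: norm_continuous.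
have bS : bounded_set Sph by exists 1; split=> // M M1 x /= ->; exact: ltW.
have [|u [Su clu]] := bounded_closed_compact bS cS (F := v @ \oo)
    (fmap_proper_filter v eventually_filter).
  by exists 0%N => // k _; exact: normv.
exists u; split.
- by rewrite -normr_gt0 Su.
- rewrite [Z](closure_id Z).1 // closureEcluster.
  move=> B C ZB uC; apply: clu uC.
  by exists 0%N => // k _; apply: ZB; have [_ + _ _] := bP k; exact: sZ.
move=> t; rewrite [A](closure_id A).1 // => B /nbhs_ballP[e e0 eB].
have e20 : 0 < e / 2 by rewrite divr_gt0.
have t10 : 0 < `|t| + 1 by rewrite ltr_wpDl.
(* The [+ 1] keeps the divisor positive when [t = 0]. *)
have d0 : 0 < e / 2 / (`|t| + 1) by rewrite divr_gt0.
have [N _ NP] := near_infty_natSinv_lt (PosNum e20).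
have [w [[k /= Nk <-]]] :
    v @` [set k | (N <= k)%N] `&` ball u (e / 2 / (`|t| + 1)) !=set0.
  apply: clu; last exact: nbhsx_ballx.
  by exists N => // k /= Nk; exists k.
rewrite -ball_normE /= => uvk.
set m := Num.floor (t / `|b k|).
exists (b k *~ m); split.
  by apply: subgroup_mulrz => //; have [] := bP k.
apply: eB; rewrite -ball_normE /=.
(* The first summand is the error on the direction, below [e / 2] by the choice of [k]. The second
   is the fractional part of [t / |b k|], at most 1, times [b k], whose norm is below [e / 2]. *)
rewrite (_ : _ - _ = t *: (u - v k) + (t / `|b k| - m%:~R) *: b k); last first.
  by rewrite scalerBr scalerBl scalerA addrA subrK scaler_int.
rewrite (le_lt_trans (ler_normD _ _))// (splitr e) ltrD// normrZ.
  rewrite (@le_lt_trans _ _ ((`|t| + 1) * `|u - v k|))//.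
    by rewrite ler_wpM2r// lerDl.
  by rewrite mulrC -ltr_pdivlMr.
apply: (@le_lt_trans _ _ `|b k|); last first.
  by have [_ _ _ /lt_trans] := bP k; apply; exact: NP.
rewrite -[leRHS]mul1r ler_wpM2r// ger0_norm ?subr_ge0 ?floor_le//.
rewrite lerBlDr ltW // addrC -[1]/(1%:~R) -intrD; exact: floorD1_gt.
Qed.

(** Take a subspace [U] inside [A] of maximal dimension and a projection [p] onto it. Arbitrarily
    small nonzero elements of [A] in the kernel of [p] would yield a further line inside [A],
    against maximality. Otherwise [U] is both open and closed in [A], and connectedness gives
    [A = U]. *)
Lemma closed_connected_subgroup A : closed A -> connected A -> A 0 ->
  (forall x y, A x -> A y -> A (x - y)) ->
  exists U : {vspace 'rV[R]_n}, A = [set x | x \in U].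
Proof.
move=> cA conA A0 AB.
have AD x y : A x -> A y -> A (x + y).
  by move=> Ax Ay; rewrite -[y]opprK; apply: (AB) => //; rewrite -sub0r; exact: AB.
pose P d := `[< exists2 U : {vspace 'rV[R]_n}, [set` U] `<=` A & \dim U = d >].
have exP : exists d, P d.
  exists 0%N; apply/asboolP; exists 0%VS; last exact: dimv0.
  by move=> x /=; rewrite memv0 => /eqP ->.
have ubP d : P d -> (d <= \dim {:'rV[R]_n})%N.
  by move=> /asboolP[U _ <-]; exact/dimvS/subvf.
case: (ex_maxnP exP ubP) => d /asboolP[U UA dU] maxU; exists U.
pose p := projv U.
have cp : continuous p := @linear_rV_continuous R n _ (p : {linear _ -> _}).
have cq : continuous (fun x : 'rV[R]_n => x - p x : 'rV[R]_n).
  move=> x; exact: (@continuousB R 'rV[R]_n 'rV[R]_n id p x cvg_id (cp x)).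
have closed0 : closed [set 0 : 'rV[R]_n].
  exact/accessible_closed_set1/hausdorff_accessible/norm_hausdorff.
have [[e e0 eA]|nosmall] := pselect (exists2 e, 0 < e &
    forall x, A x -> p x = 0 -> `|x| < e -> x = 0); last first.
  have [|t x|e e0|u [u0 pu Au]] := @closed_subgroup_line A (p @^-1` [set 0]) cA A0 AB.
  - by apply: closed_comp => [x _|]; [exact: cp|exact: closed0].
  - by move=> /= px; rewrite linearZ /= px scaler0.
  - apply: contrapT => nb; apply: nosmall; exists e => // x Ax px xe.
    by apply: contrapT => /eqP x0; apply: nb; exists x.
  have UuA : [set` (U + <[u]>)%VS] `<=` A.
    move=> _ /memv_addP[x xU [_ /vlineP[t ->] ->]].
    by apply: (AD) => //; exact: UA.
  have /maxU : P (\dim (U + <[u]>)) by apply/asboolP; exists (U + <[u]>)%VS.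
  (* Maximality puts [u] in [U], so [u = p u = 0], a contradiction. *)
  rewrite -dU (geq_leqif (dimv_leqif_sup (addvSl _ _))) subv_add subvv /=.
  rewrite -memvE => uU; move: u0.
  by rewrite -[u](projv_id uU) -/p pu eqxx.
apply/esym/conA; first by exists 0; exact: mem0v.
- exists ((fun x => x - p x) @^-1` ball 0 e).
    apply: open_comp; last exact: ball_open.
    by move=> x _; exact: cq.
  apply/seteqP; split=> x /=.
    move=> xU; split; first exact: UA.
    by rewrite /p projv_id // subrr; exact: ballxx.
  (* The difference [x - p x] lies in [A] and in the kernel of [p] and is smaller than [e], so it
     vanishes. *)
  move=> [Ax]; rewrite -ball_normE /= sub0r normrN => xe.
  suff : x - p x = 0 by move=> /subr0_eq ->; exact: memv_proj.
  apply: eA => //; first by apply: (AB) => //; apply: UA; exact: memv_proj.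
  by rewrite linearB /= /p projv_proj subrr.
- exists ((fun x => x - p x) @^-1` [set 0]).
    apply: closed_comp; last exact: closed0.
    by move=> x _; exact: cq.
  apply/seteqP; split=> x /=.
    by move=> xU; split; [exact: UA|rewrite /p projv_id // subrr].
  by move=> [_ /subr0_eq ->]; exact: memv_proj.
Qed.

End ClosedSubgroups.

(** * Orthogonal projections *)

Section OrthogonalProjection.
Variables (R : realType) (V : vectType R) (ip : {dot V for idfun}).
Implicit Types (U : {vspace V}) (X Y Z : V).

Lemma ip_sym X Y : ip X Y = ip Y X.
Proof. by rewrite hermC expr0 mul1r. Qed.

Lemma ipDl X Y Z : ip (X + Y) Z = ip X Z + ip Y Z.
Proof. exact: linearDl. Qed.

Lemma ipZl a X Z : ip (a *: X) Z = a * ip X Z.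
Proof. exact: linearZl_LR. Qed.

Lemma ipBl X Y Z : ip (X - Y) Z = ip X Z - ip Y Z.
Proof. by rewrite -[- Y]scaleN1r ipDl ipZl mulN1r. Qed.

Lemma ipDr X Y Z : ip Z (X + Y) = ip Z X + ip Z Y.
Proof. by rewrite ip_sym ipDl ![ip _ Z]ip_sym. Qed.

Lemma ipZr a X Z : ip Z (a *: X) = a * ip Z X.
Proof. by rewrite ip_sym ipZl ip_sym. Qed.

Lemma ip0l Z : ip 0 Z = 0.
Proof. by rewrite -(scale0r 0) ipZl mul0r. Qed.

Lemma ip0r Z : ip Z 0 = 0.
Proof. by rewrite ip_sym ip0l. Qed.

Lemma ip_eq0 X : ip X X = 0 -> X = 0.
Proof.
move=> XX; apply/eqP; apply: contraTT isT => X0.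
by have := @neq0_dnorm_gt0 _ _ _ ip X X0; rewrite XX ltxx.
Qed.

(** Gram-Schmidt along a basis of [U]: [w] is the part of the new vector [v] orthogonal to [span s],
    and the component of [X] gains the term [c *: w]. *)
Lemma orthogonal_decomposition U X :
  exists2 Y, Y \in U & forall Z, Z \in U -> ip (X - Y) Z = 0.
Proof.
rewrite -(span_basis (vbasisP U)); elim: (vbasis U : seq V) X => [|v s IH] X.
  by exists 0 => [|Z]; rewrite ?mem0v// span_nil memv0 => /eqP ->; rewrite ip0r.
have [v1 v1s vP] := IH v; have [Y Ys YP] := IH X.
set w := v - v1 in vP; pose c := ip (X - Y) w / ip w w.
have wvs : w \in span (v :: s).
  rewrite span_cons memvB //; first by rewrite (subvP (addvSl _ _)) ?memv_line.
  by rewrite (subvP (addvSr _ _)).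
exists (Y + c *: w).
  by rewrite memvD ?memvZ// span_cons (subvP (addvSr _ _)).
move=> Z; rewrite span_cons => /memv_addP[_ /vlineP[k ->] [z zs ->]].
have split_v : k *: v + z = k *: w + (k *: v1 + z).
  by rewrite addrA -scalerDr subrK.
have zs' : k *: v1 + z \in span s by rewrite memvD ?memvZ.
rewrite split_v opprD addrA ipDr [ip _ (k *: v1 + z)]ipBl YP // ipZl vP // mulr0.
rewrite subr0 addr0 ipZr ipBl ipZl -/w.
(* If [w = 0], the quotient [c] has denominator zero, which is harmless because every remaining term
   pairs with [w]. *)
have [->|w0] := eqVneq w 0; first by rewrite !ip0r mulr0 subr0 mulr0.
by rewrite /c divfK ?subrr ?mulr0// gt_eqF// neq0_dnorm_gt0.
Qed.

Variable U : {vspace V}.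
Let h := [set X | X \in U].

(** The orthogonal projection onto the complement of [U], with kernel [U], written as the composite
    of [dpi] and [slin] that occurs in [horizontal_section]. *)
Definition orthproj X := slin ip h (dpi h X).

Lemma dpiP X Y : dpi h X = dpi h Y <-> X - Y \in U.
Proof.
split=> [XY|XY].
  have : dpi h X X by exists 0; rewrite ?addr0//; exact: mem0v.
  by rewrite XY => -[Z ZU <-]; rewrite addrC addKr.
apply/seteqP; split=> _ [Z ZU <-].
  by exists (X - Y + Z); [exact: memvD|rewrite addrA subrKC].
exists (Y - X + Z); last by rewrite addrA subrKC.
by rewrite /h/= memvD// -opprB memvN.
Qed.

(** The set from which [slin] picks contains [X] minus its component in [U], so the default value of
    [xget] does not come into play. *)
Lemma orthproj_spec X : orthocomp ip h (orthproj X) /\ X - orthproj X \in U.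
Proof.
have [Y YU YP] := orthogonal_decomposition U X.
have [|? /esym/dpiP] // := @xgetPex _ 0
  [set Z | orthocomp ip h Z /\ dpi h Z = dpi h X].
by exists (X - Y); split=> [|]; [exact: YP|apply/dpiP; rewrite addrAC subrr add0r memvN].
Qed.

Lemma orthproj_perp X Z : Z \in U -> ip (orthproj X) Z = 0.
Proof. by move=> ZU; apply: (orthproj_spec X).1. Qed.

Lemma orthproj_sub X : X - orthproj X \in U.
Proof. exact: (orthproj_spec X).2. Qed.

Lemma orthproj_unique X Y : (forall Z, Z \in U -> ip Y Z = 0) -> X - Y \in U ->
  orthproj X = Y.
Proof.
move=> YP XY; apply/subr0_eq/ip_eq0.
have d : orthproj X - Y \in U.
  have -> : orthproj X - Y = X - Y - (X - orthproj X).
    by rewrite opprB [RHS]addrC addrA subrK.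
  by rewrite memvB ?orthproj_sub.
by rewrite ipBl orthproj_perp // YP // subrr.
Qed.

Lemma orthproj_is_linear : linear orthproj.
Proof.
move=> a X Y; apply: orthproj_unique => [Z ZU|].
  by rewrite ipDl ipZl !orthproj_perp // mulr0 addr0.
by rewrite opprD addrACA -scalerBr memvD ?memvZ ?orthproj_sub.
Qed.

HB.instance Definition _ := GRing.isLinear.Build _ _ _ _ orthproj orthproj_is_linear.

Lemma orthproj_idem X : orthproj (orthproj X) = orthproj X.
Proof.
by apply: orthproj_unique => [Z|]; [exact: orthproj_perp|rewrite subrr mem0v].
Qed.

Lemma orthproj_eq0 X : (orthproj X == 0) = (X \in U).
Proof.
apply/eqP/idP => [X0|XU]; first by have := orthproj_sub X; rewrite X0 subr0.
by apply: orthproj_unique => [Z _|]; [exact: ip0l|rewrite subr0].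
Qed.

(** By Pythagoras the squared norms of [X] and of its projection differ by that of [D]. *)
Lemma orthproj_norm_eq X : ip X X = ip (orthproj X) (orthproj X) -> X = orthproj X.
Proof.
move=> XP; apply/subr0_eq/ip_eq0; set D := X - _.
have PD : ip (orthproj X) D = 0 by apply/orthproj_perp/orthproj_sub.
have XE : X = D + orthproj X by rewrite subrK.
clearbody D; move: XP; rewrite {1 2}XE ipDl !ipDr [ip D (orthproj X)]ip_sym PD.
by rewrite addr0 add0r -[RHS]add0r => /addIr.
Qed.

End OrthogonalProjection.

(** * Smooth maps and tangent maps *)

Section SmoothMaps.
Variable R : realType.
Implicit Types M N K : manifold R.

Lemma chart_image_open (T : topologicalType) n (c : chart R T n) (A : set T) :
  open A -> A `<=` cdom c -> open (cmap c @` A).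
Proof.
move=> oA Ac; rewrite openE => _ [p Ap <-]; rewrite /interior.
have cp : (cmap c @` cdom c) (cmap c p) by exists p => //; exact: Ac.
have : \forall x \near cmap c p, (cmap c @` cdom c) x /\ A (cinv c x).
  apply: filterI; first by apply: open_nbhs_nbhs; split => //; exact: ccod_open.
  apply: cinv_continuous => //; rewrite cmapK; last exact: Ac.
  exact: open_nbhs_nbhs.
by apply: filterS => x [[q cq <-]]; rewrite cmapK // => Aq; exists q.
Qed.

Lemma open_preimage_on (T T' : topologicalType) (W : set T) (f : T -> T') (B : set T') :
  open W -> (forall p, W p -> {for p, continuous f}) -> open B ->
  open (W `&` f @^-1` B).
Proof.
move=> oW cf oB; rewrite openE => p [Wp Bfp]; apply: filterI.
  exact: open_nbhs_nbhs.
by apply: cf => //; exact: open_nbhs_nbhs.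
Qed.

Lemma smooth_map_on_comp M N K (W : set M) (f : M -> N) (g : N -> K) :
  open W -> smooth_map_on W f -> smooth_map g -> smooth_map_on W (g \o f).
Proof.
move=> oW [cf sf] [cg sg]; split=> [p Wp|c c2 ac ac2 k].
  by apply: continuous_comp; [exact: cf|exact: cg].
apply: Ck_pointwise => _ [p [[Wp cp] c2p] <-].
have [c1 [ac1 c1p]] := satlas_cover (mstruct N) (f p).
(* On [A] the coordinate expression of [g \o f] factors through the intermediate chart [c1] around
   [f p], so [Ck_comp] applies. *)
pose A := W `&` f @^-1` (cdom c1 `&` g @^-1` cdom c2) `&` cdom c.
have oA : open A.
  apply: openI; last exact: cdom_open.
  apply: open_preimage_on => //; apply: open_preimage_on (cdom_open c1) _ (cdom_open c2).
  by move=> q _; exact: cg.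
exists (cmap c @` A); first by exists p.
have oU : open (cmap c @` A) by apply: chart_image_open => // q [].
pose B := cdom c1 `&` g @^-1` cdom c2.
have oB : open B.
  by apply: open_preimage_on (cdom_open c1) _ (cdom_open c2) => q _; exact: cg.
have oV : open (cmap c1 @` B) by apply: chart_image_open => // q [].
apply: (@eq_Ck _ _ _ _ _ ((cmap c2 \o g \o cinv c1) \o (cmap c1 \o f \o cinv c))) => //.
  by move=> _ /[!inE] -[q [[Wq [c1q c2q]] cq] <-] /=; rewrite !cmapK // cmapK.
apply: (Ck_comp oU oV).
- by move=> _ [_ [q [[Wq Bq] cq] <-] <-]; exists (f q) => //=; rewrite cmapK.
- apply: Ck_subset (sf c c1 ac ac1 k).
  by move=> _ [q [[Wq [c1q c2q]] cq] <-]; exists q.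
- by apply: Ck_subset (sg c1 c2 ac1 ac2 k) => _ [q [c1q c2q] <-]; exists q.
Qed.

Lemma smooth_map_comp M N K (f : M -> N) (g : N -> K) :
  smooth_map f -> smooth_map g -> smooth_map (g \o f).
Proof. by move=> sf sg; apply: smooth_map_on_comp => //; exact: openT. Qed.

Lemma smooth_map_id M : smooth_map (@id M).
Proof.
split=> [p _|c c' ac ac' k]; first exact: cvg_id.
by apply: Ck_subset (satlas_compat ac ac' k) => _ [p [[_ cp] c'p] <-]; exists p.
Qed.

Lemma eq_smooth_map_on M N (W : set M) (f g : M -> N) : open W ->
  {in W, f =1 g} -> smooth_map_on W f -> smooth_map_on W g.
Proof.
move=> oW fg [cf sf]; have near_fg p : W p -> {near p, f =1 g}.
  by move=> Wp; apply: filterS (open_nbhs_nbhs (conj oW Wp)) => q Wq; rewrite fg // inE.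
have cg p : W p -> {for p, continuous g}.
  move=> Wp; rewrite /prop_for /continuous_at -(nbhs_singleton (near_fg _ Wp)).
  by apply: cvg_trans (cf p Wp); apply: near_eq_cvg; exact: near_fg.
split=> // c c' ac ac' k.
apply: (@eq_Ck _ _ _ _ _ (cmap c' \o f \o cinv c)).
- rewrite setIAC; apply: chart_image_open; last by move=> q [].
  apply: openI; last exact: cdom_open.
  by apply: open_preimage_on => //; exact: cdom_open.
- by move=> _ /[!inE] -[q [[Wq cq] c'q] <-] /=; rewrite !cmapK // fg // inE.
apply: Ck_subset (sf c c' ac ac' k) => _ [q [[Wq cq] c'q] <-]; exists q => //.
by split=> //; rewrite /preimage /= fg // inE.
Qed.

Lemma smooth_map_local M N (f : M -> N) :
  (forall p, exists W, [/\ open W, W p & smooth_map_on W f]) -> smooth_map f.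
Proof.
move=> h; split=> [p _|c c' ac ac' k].
  by have [W [_ Wp [cf _]]] := h p; exact: cf.
apply: Ck_pointwise => _ [p [[_ cp] c'p] <-]; have [W [_ Wp [_ sf]]] := h p.
by exists (cmap c @` (W `&` cdom c `&` f @^-1` cdom c')); [exists p|exact: sf].
Qed.

Lemma smooth_map_continuous M N (f : M -> N) : smooth_map f -> continuous f.
Proof. by move=> [cf _] p; exact: cf. Qed.

Lemma chart_atP M (p : M) : charts_at p (chart_at p).
Proof. by rewrite /chart_at; case: cid. Qed.

Section Tangent.
Variables (M N : manifold R) (f : M -> N).
Hypothesis sf : smooth_map f.

Lemma smooth_map_differentiable p c c' : charts_at p c -> charts_at (f p) c' ->
  differentiable (cmap c' \o f \o cinv c) (cmap c p).
Proof.
move=> [ac cp] [ac' c'p]; have [_ /(_ c c' ac ac' 1%N) [+ _]] := sf; apply.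
by exists p.
Qed.

(** The factor [cinv c' \o cmap c'] cancels only on the domain of [c']; continuity of [f] keeps the
    images of nearby points there. Equality near the point suffices to compare differentials. *)
Lemma chart_comp_near K p (c : chart R M (mdim M)) (c' : chart R N (mdim N))
    (g : N -> 'rV[R]_(mdim K)) : charts_at p c -> charts_at (f p) c' ->
  {near cmap c p, (g \o cinv c') \o (cmap c' \o f \o cinv c) =1 g \o f \o cinv c}.
Proof.
move=> [ac cp] [ac' c'p].
have : \forall x \near cmap c p, cdom c' (f (cinv c x)).
  have cc : (f \o cinv c) @ cmap c p --> f (cinv c (cmap c p)).
    apply: continuous_comp; last exact: smooth_map_continuous.
    by apply: cinv_continuous; exists p.
  apply: cc; rewrite cmapK //; apply: open_nbhs_nbhs; split=> //; exact: cdom_open.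
by apply: filterS => x c'x /=; rewrite cmapK.
Qed.

End Tangent.

Lemma diff_chart_comp M N K (f : M -> N) (g : N -> K) p c c' c2 x :
  smooth_map f -> smooth_map g ->
  charts_at p c -> charts_at (f p) c' -> charts_at (g (f p)) c2 ->
  'd (cmap c2 \o g \o cinv c') (cmap c' (f p))
     ('d (cmap c' \o f \o cinv c) (cmap c p) x) =
  'd (cmap c2 \o (g \o f) \o cinv c) (cmap c p) x.
Proof.
move=> sf sg pc pc' pc2.
have df := smooth_map_differentiable sf pc pc'.
have dg : differentiable (cmap c2 \o g \o cinv c') ((cmap c' \o f \o cinv c) (cmap c p)).
  by rewrite /= cmapK; [exact: smooth_map_differentiable|case: pc].
rewrite -(near_eq_diff x (chart_comp_near sf (cmap c2 \o g) pc pc')).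
  by rewrite (diff_comp df dg) /= cmapK //; case: pc.
exact: differentiable_comp.
Qed.

Lemma tmap_comp M N K (f : M -> N) (g : N -> K) p v :
  smooth_map f -> smooth_map g ->
  tmap (g \o f) p v = tmap g (f p) (tmap f p v).
Proof.
move=> sf sg; apply/funext => c2; rewrite /tmap /=; case: asboolP => // pc2.
case: asboolP => [_|]; last by case; exact: chart_atP.
by rewrite (diff_chart_comp _ sf sg) //; exact: chart_atP.
Qed.

Lemma tmap_tangent M N (f : M -> N) p v : smooth_map f -> tangent (f p) (tmap f p v).
Proof.
move=> sf; split=> [c c' pc pc'|c pc]; rewrite /tmap; last by case: asboolP.
do 2 (case: asboolP => // _).
(* The transition rule is the chain rule for [f] followed by the identity, whose expression in the
   charts [c] and [c'] is the transition map. *)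
have := diff_chart_comp (v (chart_at p)) sf (@smooth_map_id N) (chart_atP p) pc pc'.
by rewrite (_ : cmap c' \o id \o cinv c = cmap c' \o cinv c).
Qed.

Lemma tmap_id M (p : M) v : tangent p v -> tmap id p v = v.
Proof.
move=> [tv v0]; apply/funext => c; rewrite /tmap; case: asboolP => [pc|/v0 //].
by rewrite (tv (chart_at p) c) //; exact: chart_atP.
Qed.

Lemma tmap0 M N (f : M -> N) p : tmap f p 0 = 0.
Proof. by apply/funext => c; rewrite /tmap linear0; case: ifP. Qed.

End SmoothMaps.

(** * Differentials of additive maps *)

(** Additivity gives compatibility with division by a positive integer [n], so [f x - 'd f 0 x] is
    [n] times the remainder at [x / n], and this is arbitrarily small for large [n]. *)
Lemma diff_additive (R : realType) (E F : normedModType R) (f : E -> F) :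
  (forall x y, f (x + y) = f x + f y) -> differentiable f 0 ->
  forall x, 'd f 0 x = f x.
Proof.
move=> fD df x.
have f0 : f 0 = 0 by apply: (@addrI _ (f 0)); rewrite -fD !addr0.
have fM n y : f (y *+ n) = f y *+ n.
  by elim: n => [|n IH]; rewrite ?mulr0n// !mulrS fD IH.
apply/esym/subr0_eq/eqP; rewrite -normr_le0; apply/ler_addgt0Pl => e e0.
rewrite addr0; have x10 : 0 < `|x| + 1 by rewrite ltr_wpDl.
(* The constant [e / (|x| + 1)] absorbs the factor [|x|] in the bound on the remainder. *)
have /diff_locallyP[_ /eqaddoP /(_ (e / (`|x| + 1)))] := df.
rewrite divr_gt0 // => /(_ isT) /nbhs_ballP[d /= d0 dP].
have dx0 : 0 < d / (`|x| + 1) by rewrite divr_gt0.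
have [N _ /(_ N (leqnn N)) /= NP] := near_infty_natSinv_lt (PosNum dx0).
have N0 : (0 : R) < N.+1%:R by [].
have /dP : ball 0 d (N.+1%:R^-1 *: x).
  rewrite -ball_normE /= sub0r normrN normrZ gtr0_norm ?invr_gt0//.
  rewrite (@le_lt_trans _ _ (N.+1%:R^-1 * (`|x| + 1)))//.
    by rewrite ler_wpM2l ?invr_ge0// lerDl.
  by rewrite -ltr_pdivlMr.
rewrite !fctE /= addr0 f0 add0r => fx.
have -> : f x - 'd f 0 x =
    N.+1%:R *: (f (N.+1%:R^-1 *: x) - 'd f 0 (N.+1%:R^-1 *: x)).
  rewrite scalerBr -[in RHS]linearZ /= scalerA mulfV ?gt_eqF// scale1r.
  by rewrite scaler_nat -fM -scaler_nat scalerA mulfV ?gt_eqF// scale1r.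
rewrite normrZ gtr0_norm// -ler_pdivlMl//; apply: le_trans fx _.
rewrite normrZ gtr0_norm ?invr_gt0// mulrCA ler_wpM2l ?invr_ge0//.
by rewrite -mulrA ler_piMr ?(ltW e0)// mulrC ler_pdivrMr// mul1r lerDl.
Qed.

(** * A vector space as a manifold *)

Section VectorSpace.
Variables (R : realType) (V : vectType R).
Local Notation Vm := (vspace_manifold V).

(** The identification of tangent spaces of [V] with [V], read in the only chart of the atlas;
    [vspace_metric ip] is [ip] through it. *)
Definition tval (v : tvec Vm) : V := r2v (v (vspace_chart V) : 'rV[R]_(dim V)).

Lemma vspace_chart_at (x : Vm) : chart_at x = vspace_chart V.
Proof. by have [] := chart_atP x. Qed.

Lemma tval_tmap (T : V -> V) (x : V) (v : tvec Vm) :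
  tval (@tmap R Vm Vm T x v) =
  r2v ('d (v2r \o T \o r2v) (v2r x) (v2r (tval v))).
Proof.
rewrite /tval /tmap vspace_chart_at r2vK; case: asboolP => //.
by case; split.
Qed.

Lemma linear_smooth (L : {linear V -> V}) : @smooth_map R Vm Vm L.
Proof.
pose f : {linear 'rV[R]_(dim V) -> 'rV[R]_(dim V)} := v2r \o L \o r2v.
have cf : continuous f by exact: linear_rV_continuous.
split=> [p _|_ _ -> -> k].
  have -> : L = r2v \o (f \o v2r) :> (V -> V) by apply/funext => x /=; rewrite !v2rK.
  apply: continuous_comp; last exact: r2v_vspace_continuous.
  by apply: continuous_comp; [exact: v2r_vspace_continuous|exact: cf].
apply: (@Ck_subset _ _ _ _ _ setT) => //.
by apply: (@Ck_comp_lin _ _ _ _ _ _ f id) => //; [exact: openT|exact: Cinfty_id].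
Qed.

Lemma tval_tmap_linear (L : {linear V -> V}) (x : V) v :
  tval (@tmap R Vm Vm L x v) = L (tval v).
Proof.
pose f : {linear 'rV[R]_(dim V) -> 'rV[R]_(dim V)} := v2r \o L \o r2v.
rewrite tval_tmap -/f (@diff_lin _ _ _ f); last exact: linear_rV_continuous.
by rewrite /f /= !v2rK.
Qed.

Lemma tval_tmap_additive (T : V -> V) v :
  (forall X Y, T (X + Y) = T X + T Y) -> @smooth_map R Vm Vm T ->
  tval (@tmap R Vm Vm T 0 v) = T (tval v).
Proof.
move=> TD sT; rewrite tval_tmap linear0 diff_additive /=; first by rewrite !v2rK.
  by move=> x y; rewrite linearD TD linearD.
have := @smooth_map_differentiable R Vm Vm T sT 0 (vspace_chart V) (vspace_chart V).
by rewrite /= linear0; apply; split.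
Qed.

End VectorSpace.

(** * Log-Euclidean groups *)

Section LogEuclidean.
Variables (R : realType) (V : vectType R) (G : logEuclideanGroup V).
Local Notation Vm := (vspace_manifold V).
Local Notation log := (logG G : le_manifold G -> Vm).
Local Notation exp := (expG G : Vm -> le_manifold G).

Lemma logK : cancel (logG G) (expG G).
Proof. by have [] := logG_diffeomorphism G. Qed.

Lemma expK : cancel (expG G) (logG G).
Proof. by have [] := logG_diffeomorphism G. Qed.

Lemma log_smooth : smooth_map log.
Proof. by have [] := logG_diffeomorphism G. Qed.

Lemma exp_smooth : smooth_map exp.
Proof. by have [] := logG_diffeomorphism G. Qed.

Lemma log_mul (u v : G) : logG G (lemul u v) = logG G u + logG G v.
Proof. exact: expK. Qed.

(** In linear coordinates [log_G(H)] is closed as a preimage of [H] and connected as an image of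
    [H], both under continuous maps, and [closed_connected_subgroup] applies. *)
Lemma lie_sub_vspace (H : set G) : subgroup H -> connected H -> closed H ->
  exists U : {vspace V}, lie_sub H = [set X | X \in U].
Proof.
move=> [H1 HM HV] conH cH.
pose A : set 'rV[R]_(dim V) := (fun p : G => v2r (logG G p)) @` H.
have AP x : A x <-> H (expG G (r2v x)).
  split=> [[p Hp <-]|Hx]; first by rewrite v2rK logK.
  by exists (expG G (r2v x)) => //; rewrite expK r2vK.
have [||||U0 AU] := @closed_connected_subgroup R (dim V) A.
- have -> : A = (fun x => expG G (r2v x)) @^-1` H by apply/seteqP; split=> x /AP.
  apply: closed_comp => // x _; apply: (@continuous_comp _ _ _ (r2v : _ -> Vm) exp).
    exact: r2v_vspace_continuous.
  exact: (smooth_map_continuous exp_smooth).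
- apply: connected_continuous_connected => //; apply: continuous_subspaceT => p.
  apply: (@continuous_comp _ _ _ (log) (v2r : Vm -> _)).
    exact: (smooth_map_continuous log_smooth).
  exact: v2r_vspace_continuous.
- by apply/AP; rewrite linear0.
- move=> _ _ [p Hp <-] [q Hq <-]; exists (lemul p (leinv q)); last first.
    by rewrite log_mul expK linearB.
  by apply: HM => //; exact: HV.
exists (linfun v2r @^-1: U0)%VS; apply/seteqP; split=> [_ [p Hp <-]|X] /=.
  rewrite -memv_preim lfunE /=; have : A (v2r (logG G p)) by exists p.
  by rewrite AU.
rewrite -memv_preim lfunE /= => XU; have : A (v2r X) by rewrite AU.
by move=> /AP; rewrite v2rK => HX; exists (expG G X) => //; rewrite expK.
Qed.

(** * Cosets and the horizontal section *)

Variables (H : set G).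
Local Notation pi := (coset_proj H).

Lemma lcosetE p : lcoset H p = expG G @` dpi (lie_sub H) (logG G p).
Proof.
by rewrite /lcoset /dpi /lie_sub !image_comp; apply: eq_imagel.
Qed.

Variable U : {vspace V}.
Hypothesis HU : lie_sub H = [set X | X \in U].

(** Cosets of [H] are the images under [expG] of cosets of [U], and [expG] is injective. *)
Lemma coset_projP p q : pi p = pi q <-> logG G p - logG G q \in U.
Proof.
rewrite -dpiP -HU.
have -> : (pi p = pi q) <-> lcoset H p = lcoset H q.
  by split=> [/eqmodP /asboolP //|pq]; apply/eqmodP/asboolP.
rewrite !lcosetE; split=> [|-> //]; move: (dpi _ (logG G p)) (dpi _ (logG G q)) => A B AB.
have cancelA (C : set V) : logG G @` (expG G @` C) = C.
  by rewrite image_comp eq_image_id// => X _; exact: expK.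
by rewrite -[A]cancelA AB cancelA.
Qed.

Lemma repr_coset p : logG G (repr (pi p)) - logG G p \in U.
Proof. by apply/coset_projP; rewrite /pi reprK. Qed.

Lemma coset_projK (a : coset_space H) : pi (repr a) = a.
Proof. exact: reprK. Qed.

Lemma cosetmul_proj p q : cosetmul (pi p) (pi q) = pi (lemul p q).
Proof.
by apply/coset_projP; rewrite !log_mul opprD addrACA memvD ?repr_coset.
Qed.

Variable ip : {dot V for idfun}.
Local Notation s := (horizontal_section ip H).
Local Notation P := (orthproj ip U).

Lemma horizontal_sectionE (a : coset_space H) : s a = expG G (P (logG G (repr a))).
Proof. by rewrite /horizontal_section HU. Qed.

(** [P] vanishes on [U], so the representative chosen by [repr] does not matter. *)
Lemma horizontal_section_proj p : s (pi p) = expG G (P (logG G p)).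
Proof.
rewrite horizontal_sectionE; congr expG; apply/subr0_eq; rewrite -linearB.
by apply/eqP; rewrite orthproj_eq0 repr_coset.
Qed.

Lemma horizontal_sectionK : cancel s pi.
Proof.
move=> a; rewrite horizontal_sectionE -[RHS]coset_projK; apply/coset_projP.
by rewrite expK -memvN opprB orthproj_sub.
Qed.

Lemma horizontal_section_mul a b : s (cosetmul a b) = lemul (s a) (s b).
Proof.
by rewrite horizontal_section_proj !horizontal_sectionE /lemul !expK linearD.
Qed.

Lemma horizontal_section_range : subgroup (range s).
Proof.
split=> [|_ _ [a _ <-] [b _ <-]|_ [a _ <-]].
- exists (pi (leone G)) => //.
  by rewrite horizontal_section_proj expK linear0.
- by exists (cosetmul a b); rewrite ?horizontal_section_mul.
- exists (pi (leinv (repr a))) => //.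
  by rewrite horizontal_section_proj horizontal_sectionE /leinv !expK linearN.
Qed.

Variable S : smoothStructure R (coset_space H).
Local Notation Q := (coset_manifold H S).

Lemma horizontal_section_smooth : homogeneous_structure S -> @smooth_map R Q G s.
Proof.
move=> [spi loc]; apply: smooth_map_local => a.
have [W [tau [oW Wa stau tauK]]] := loc a; exists W; split=> //.
apply: (@eq_smooth_map_on R Q G W ((exp \o (P \o log)) \o tau)) => //.
  by move=> b; rewrite inE => Wb /=; rewrite -[in RHS](tauK _ Wb) horizontal_section_proj.
apply: (@smooth_map_on_comp R Q G G) => //.
apply: (@smooth_map_comp R G Vm G) exp_smooth.
exact: (@smooth_map_comp R G Vm Vm) log_smooth (linear_smooth _).
Qed.

(** The smooth left inverse [pi] does everything: differentiating [pi \o f = id] makes the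
    differential of [f] injective, and an open set of [Q] is the trace under [f] of its preimage by
    [pi]. *)
Lemma section_embedding (f : Q -> G) : @smooth_map R G Q pi ->
  @smooth_map R Q G f -> cancel f pi -> @smooth_embedding R Q G f.
Proof.
move=> spi sf fK; have pif : pi \o f = @id Q by apply/funext => a; exact: fK.
have dfK p v : tangent p v -> @tmap R G Q pi (f p) (@tmap R Q G f p v) = v.
  by move=> tv; rewrite -(@tmap_comp R Q G Q f pi p v sf spi) pif tmap_id.
split=> // [p v w tv tw vw||B oB].
- by rewrite -(dfK p v tv) vw dfK.
- exact: can_inj fK.
- exists (pi @^-1` B).
    by apply: open_comp => // x _; exact: (smooth_map_continuous spi).
  by rewrite -comp_preimage pif.
Qed.

(** The differential of [log_G] with values in [V], that is, the Maurer-Cartan form of the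
    commutative group [G]. *)
Definition dlog (p : G) (v : tvec G) : V := tval (@tmap R G Vm log p v).

Lemma le_metricE p v w : le_metric G ip p v w = ip (dlog p v) (dlog p w).
Proof. by []. Qed.

(** * Isometry and uniqueness *)

Hypothesis spi : @smooth_map R G Q pi.
Hypothesis ss : @smooth_map R Q G s.

Lemma dlog_horizontal_section (a : Q) v :
  dlog (s a) (@tmap R Q G s a v) = P (dlog (s a) (@tmap R Q G s a v)).
Proof.
have sls : @smooth_map R Q Vm (log \o s) := smooth_map_comp ss log_smooth.
rewrite /dlog -(@tmap_comp R Q G Vm s log a v ss log_smooth).
rewrite -(@tval_tmap_linear R V P (logG G (s a))).
rewrite -(@tmap_comp R Q Vm Vm (log \o s) P a v sls (linear_smooth _)).
have -> // : P \o (log \o s) = log \o s :> (Q -> Vm).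
by apply/funext => b /=; rewrite horizontal_sectionE expK orthproj_idem.
Qed.

(** [P \o log] factors through [pi], so its differential kills vertical vectors. *)
Lemma dlog_vertical p v : @tmap R G Q pi p v = 0 -> dlog p v \in U.
Proof.
move=> v0; rewrite -(orthproj_eq0 ip) -(@tval_tmap_linear R V P (logG G p)).
rewrite -(@tmap_comp R G Vm Vm log P p v log_smooth (linear_smooth _)).
have sls : @smooth_map R Q Vm (log \o s) := smooth_map_comp ss log_smooth.
have -> : P \o log = (log \o s) \o pi :> (G -> Vm).
  by apply/funext => q /=; rewrite horizontal_section_proj expK.
by rewrite (@tmap_comp R G Q Vm pi (log \o s) p v spi sls) v0 tmap0 /tval linear0.
Qed.

Variable gQ : metric_field Q.

Lemma horizontal_section_isometric :
  @riemannian_submersion R G Q (le_metric G ip) gQ pi ->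
  @isometric_embedding R Q G gQ (le_metric G ip) s.
Proof.
move=> [_ sub]; have sK := horizontal_sectionK.
split=> [|p v w tv tw]; first exact: section_embedding.
have hor u : @horizontal R G Q (le_metric G ip) pi (s p) (@tmap R Q G s p u).
  split=> [|x tx x0]; first exact: tmap_tangent.
  by rewrite le_metricE dlog_horizontal_section orthproj_perp // dlog_vertical.
have pis : pi \o s = @id Q by apply/funext => a; exact: sK.
(* The submersion property is applied to the lifts of [v] and [w] by [s], which [pi] sends back to
   [v] and [w]. *)
have := sub (s p) _ _ (hor v) (hor w).
rewrite /pullback_metric -!(@tmap_comp R Q G Q s pi p _ ss spi) pis.
by rewrite (tmap_id tv) (tmap_id tw) sK => <-.
Qed.

(* [fun=> v2r X] is not a tangent vector, but [tmap] only reads its component at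
   the single chart of [V], where it is the coordinate vector of [X]. *)
Lemma section_dlog (f : Q -> G) X : @smooth_map R Q G f ->
  (forall a b, f (cosetmul a b) = lemul (f a) (f b)) ->
  let v := @tmap R Vm Q (pi \o exp) 0 (fun=> v2r X) in
  dlog (f (pi (leone G))) (@tmap R Q G f (pi (leone G)) v) =
  logG G (f (pi (expG G X))).
Proof.
move=> sf fM v.
have spe : @smooth_map R Vm Q (pi \o exp) := smooth_map_comp exp_smooth spi.
have slf : @smooth_map R Q Vm (log \o f) := smooth_map_comp sf log_smooth.
rewrite /dlog -(@tmap_comp R Q G Vm f log _ v sf log_smooth).
rewrite -(@tmap_comp R Vm Q Vm (pi \o exp) (log \o f) 0 _ spe slf).
rewrite tval_tmap_additive; first by rewrite /tval v2rK.
  move=> Y Z /=; rewrite -log_mul -fM cosetmul_proj; congr (logG G (f (pi _))).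
  by rewrite /lemul !expK.
exact: smooth_map_comp spe slf.
Qed.

Lemma homomorphic_isometric_section_unique (f : Q -> G) :
  @isometric_embedding R Q G gQ (le_metric G ip) s ->
  @isometric_embedding R Q G gQ (le_metric G ip) f ->
  cancel f pi -> (forall a b, f (cosetmul a b) = lemul (f a) (f b)) -> f = s.
Proof.
move=> [_ is_] [[sf _ _ _] if_] fK fM; apply/funext => a.
rewrite -[a]coset_projK -[repr a]logK; set X := logG G (repr a).
rewrite horizontal_section_proj expK -[LHS]logK; congr expG.
set v := @tmap R Vm Q (pi \o exp) 0 (fun=> v2r X).
have tv : tangent (pi (leone G) : Q) v.
  exact: (@tmap_tangent R Vm Q (pi \o exp) 0 _ (smooth_map_comp exp_smooth spi)).
(* Both sections preserve the norm of [v]; by [section_dlog] this says that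
   [logG G (f (pi (expG G X)))] and [P X] have the same norm. *)
have := etrans (if_ _ v v tv tv) (esym (is_ _ v v tv tv)).
rewrite /pullback_metric !le_metricE !section_dlog //; last exact: horizontal_section_mul.
rewrite horizontal_section_proj !expK.
(* Since [f] is a section, [X] and [logG G (f (pi (expG G X)))] differ by an element of [U]. The
   latter thus has the norm of its own projection and equals it. *)
have -> : P X = P (logG G (f (pi (expG G X)))).
  apply/esym/subr0_eq/eqP; rewrite -linearB orthproj_eq0 -[X in _ - X]expK.
  by apply/coset_projP; rewrite fK.
exact: orthproj_norm_eq.
Qed.

End LogEuclidean.

Unset Implicit Arguments.
Set Strict Implicit.

Theorem theorem4p15 (R : realType) (V : vectType R) (G : logEuclideanGroup V)
  (ip : {dot V for idfun}) (H : set G)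
  (subgroupH : subgroup H) (connectedH : connected H) (closedH : closed H)
  (S : smoothStructure R (coset_space H)) (homS : homogeneous_structure S)
  (gQ : metric_field (coset_manifold H S)) (riemQ : riemannian gQ)
  (subm : @riemannian_submersion R G (coset_manifold H S)
            (le_metric G ip) gQ (coset_proj H)) :
  let s : coset_manifold H S -> G := horizontal_section ip H in
  [/\ forall p : G, s (coset_proj H p) =
        expG G (slin ip (lie_sub H) (dpi (lie_sub H) (logG G p))),
      smooth_section S s,
      isometric_embedding gQ (le_metric G ip) s,
      lie_group_morphism S s & lie_group_iso_onto_image S s] /\
  forall sigma : coset_manifold H S -> G,
    smooth_section S sigma ->
    isometric_embedding gQ (le_metric G ip) sigma ->
    lie_group_morphism S sigma ->
    sigma = s.
Proof.
move=> s; have [U HU] := lie_sub_vspace subgroupH connectedH closedH.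
pose Q := coset_manifold H S.
have spi : @smooth_map R G Q (coset_proj H) by case: homS.
have ss : @smooth_map R Q G s := horizontal_section_smooth HU ip homS.
have sK : cancel s (coset_proj H) := horizontal_sectionK HU ip.
have sM := horizontal_section_mul HU ip.
have sI : @isometric_embedding R Q G gQ (le_metric G ip) s.
  exact: (horizontal_section_isometric HU).
split; last first.
  move=> f [sf fK] fI [_ fM].
  exact: (homomorphic_isometric_section_unique HU spi ss sI fI fK fM).
split=> //; first by move=> p; rewrite /s (horizontal_section_proj HU) HU.
split=> //; first by case: sI.
  exact: (horizontal_section_range HU).
(* The inverse on the image is the restriction of [pi], which is its own smooth extension to all of
   [G]. *)
exists (coset_proj H); split=> // p _; exists setT, (coset_proj H).
by split=> //; exact: openT.
Qed.
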